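(* Let $\mathbf{P}$ be a poset, a semilattice or a lattice. Let $W_1=\mathrm{Filt}(\mathbf{P})$, $W_\partial=\mathrm{Idl}(\mathbf{P})$, and let $I\subseteq W_1\times W_\partial$ be given by $xIy$ iff $x\cap y=\emptyset$. Let $\mathcal{G}(W_1)$ be the complete lattice of Galois stable sets of filters and let $\alpha:\mathbf{P}\to\mathcal{G}(W_1)$ be the map $\alpha(a)=\{x\in\mathrm{Filt}(\mathbf{P})\mid a\in x\}$. Then $\mathcal{G}(W_1)$, with $\alpha$, is a $\Delta_1$-completion of $\mathbf{P}$ (with respect to the filter elements and the ideal elements).
   Context: A filter of a poset $\mathbf{P}$ is a downwards directed (nonempty) upset: an upset containing a lower bound of each pair of its elements. An ideal is an upwards directed (nonempty) downset. $\mathrm{Filt}(\mathbf{P})$, $\mathrm{Idl}(\mathbf{P})$ are the sets of filters and ideals. Let $\perp$ be the complement of $I$, so here $x\perp y$ iff $x\cap y\neq\emptyset$. For $A\subseteq W_1$ let $A'=\{y\in W_\partial\mid \forall x\in A\; x\perp y\}$ and for $B\subseteq W_\partial$ let $B'=\{x\in W_1\mid\forall y\in B\; x\perp y\}$. $A\subseteq W_1$ is Galois stable if $A=A''$; $\mathcal{G}(W_1)$ is the complete lattice of Galois stable subsets of $W_1$ ordered by inclusion (meets are intersections, joins are closures $(\cdot)''$ of unions). A completion of $\mathbf{P}$ is a complete lattice $\mathbf{C}$ with an order embedding $\alpha:\mathbf{P}\to\mathbf{C}$ preserving finite joins and meets existing in $\mathbf{P}$. A filter element (closed element) of $\mathbf{C}$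 is an element $\bigwedge\alpha[x]$, for $x$ a filter of $\mathbf{P}$; an ideal element (open element) is an element $\bigvee\alpha[y]$, for $y$ an ideal of $\mathbf{P}$. The completion is a $\Delta_1$-completion if every element of $\mathbf{C}$ is a join of filter elements and also every element of $\mathbf{C}$ is a meet of ideal elements. *)

(* Defs.v *)
From HB Require Import structures.
From mathcomp Require Import all_boot all_order.
From mathcomp Require Import boolp classical_sets cardinality.

Set Implicit Arguments.
Unset Strict Implicit.
Unset Printing Implicit Defensive.

Import Order.Theory.
Local Open Scope classical_set_scope.
Local Open Scope order_scope.

Section FiltersIdeals.
Context (d : Order.disp_t) (P : porderType d).
Implicit Types (A : set P) (a b c : P).

Definition upset A : Prop := forall a b, a <= b -> A a -> A b.
Definition downset A : Prop := forall a b, a <= b -> A b -> A a.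

Definition down_directed A : Prop :=
  forall a b, A a -> A b -> exists c, [/\ A c, c <= a & c <= b].
Definition up_directed A : Prop :=
  forall a b, A a -> A b -> exists c, [/\ A c, a <= c & b <= c].

Definition is_filter A : Prop := [/\ A !=set0, upset A & down_directed A].
Definition is_ideal A : Prop := [/\ A !=set0, downset A & up_directed A].

(* Neither notion excludes the improper filter or ideal [setT]. *)
Record Filt := MkFilt { filt_set :> set P; filtP : is_filter filt_set }.
Record Idl := MkIdl { idl_set :> set P; idlP : is_ideal idl_set }.

End FiltersIdeals.

Section GaloisStable.
Context (W1 Wd : Type) (I : W1 -> Wd -> Prop).
Implicit Types (A : set W1) (B : set Wd).

Definition perp (x : W1) (y : Wd) : Prop := ~ I x y.

Definition rpolar A : set Wd := [set y | forall x, A x -> perp x y].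
Definition lpolar B : set W1 := [set x | forall y, B y -> perp x y].

Definition galois_stable A : Prop := A = lpolar (rpolar A).

Record Gset := MkGset { gset_val :> set W1; _ : `[< galois_stable gset_val >] }.

HB.instance Definition _ := [isSub for gset_val].
HB.instance Definition _ := [Choice of Gset by <:].
(* The order induced from [set W1], that is, inclusion. *)
HB.instance Definition _ := [SubChoice_isSubPOrder of Gset by <: with set_display].

End GaloisStable.

Section Completions.
Context (d d' : Order.disp_t) (P : porderType d) (C : porderType d').
Implicit Types (f : P -> C) (c : C).

Definition complete_lattice : Prop :=
  forall S : set C, supremums S !=set0 /\ infimums S !=set0.

(* Finite joins and meets include the empty ones, i.e. the bottom and the top
   of P, whenever these exist. *)
Definition preserves_finite_joins f : Prop :=
  forall (S : set P) (s : P),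
    finite_set S -> supremums S s -> supremums (f @` S) (f s).
Definition preserves_finite_meets f : Prop :=
  forall (S : set P) (s : P),
    finite_set S -> infimums S s -> infimums (f @` S) (f s).

Definition is_completion f : Prop :=
  [/\ complete_lattice, {mono f : a b / a <= b},
      preserves_finite_joins f & preserves_finite_meets f].

Definition filter_element f : set C :=
  [set c | exists x : Filt P, infimums (f @` x) c].
Definition ideal_element f : set C :=
  [set c | exists y : Idl P, supremums (f @` y) c].

Definition is_Delta1_completion f : Prop :=
  [/\ is_completion f,
      forall c, exists2 S : set C, S `<=` filter_element f & supremums S c
    & forall c, exists2 S : set C, S `<=` ideal_element f & infimums S c].

End Completions.

Section Representation.
Context (d : Order.disp_t) (P : porderType d).

Definition disj (x : Filt P) (y : Idl P) : Prop :=
  (x : set P) `&` (y : set P) = set0.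

Definition alpha_set (a : P) : set (Filt P) := [set x : Filt P | (x : set P) a].

Fact principal_idealP (a : P) : is_ideal [set b | b <= a].
Proof.
split; first by exists a => /=.
- by move=> b c /= bc /(le_trans bc).
- by move=> b c /= ba ca; exists a; split=> /=.
Qed.

(* [alpha_set a] is the polar of the principal ideal generated by [a]. *)
Fact alpha_set_stable (a : P) : galois_stable disj (alpha_set a).
Proof.
apply/seteqP; split=> x /=; first by move=> xa y; apply.
move=> /(_ (MkIdl (principal_idealP a))) H.
have /H : rpolar disj (alpha_set a) (MkIdl (principal_idealP a)).
  move=> z za zI; have : ((z : set P) `&` [set b | b <= a]) a by split=> /=.
  by rewrite [X in X a]zI.
rewrite /perp /disj => /eqP /set0P[b [xb /= ba]].
by case: (filtP x) => _ up _; apply: up ba xb.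
Qed.

Definition alpha (a : P) : Gset disj :=
  MkGset (asboolT (alpha_set_stable a)).

End Representation.

(* Main.v *)
(** Everything rests on density: a stable set [G] is an upset of filters, hence
    the join of the sets [{z | x ⊆ z}] for [x] in [G], and it is the meet of the
    sets [{z | z meets y}] for [y] in the polar of [G]. The former are the
    filter elements, being intersections of the [alpha a] for [a] in [x]; the
    latter are the ideal elements, being unions of the [alpha a] for [a] in
    [y]. Finite joins are preserved because a [y] in the polar of a stable set
    containing [alpha a] meets the principal filter of [a], i.e. contains [a]. *)
Require Import Defs.
From mathcomp Require Import all_boot all_order.
From mathcomp Require Import boolp classical_sets cardinality.

Set Implicit Arguments.
Unset Strict Implicit.
Unset Printing Implicit Defensive.

Import Order.Theory.
Local Open Scope classical_set_scope.
Local Open Scope order_scope.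

Section GaloisStable.
Context (W1 Wd : Type) (I : W1 -> Wd -> Prop).
Implicit Types (A : set W1) (B : set Wd) (G H : Gset I).

Lemma Gset_leP G H : reflect ((G : set W1) `<=` H) (G <= H).
Proof. by rewrite -Order.le_val; apply: (iffP idP); rewrite subsetEset. Qed.

Lemma Gset_stable G : galois_stable I G.
Proof. by case: G => A /= /asboolP. Qed.

Lemma Gset_polarP G x :
  (forall y, rpolar I G y -> perp I x y) <-> (G : set W1) x.
Proof. by rewrite [X in _ <-> X x]Gset_stable. Qed.

Lemma lpolar_stable B : galois_stable I (lpolar I B).
Proof.
apply/seteqP; split=> x /= xB; first by move=> y; apply.
by move=> y By; apply: xB => z; apply.
Qed.

Definition Glpolar B : Gset I := MkGset (asboolT (lpolar_stable B)).

Lemma Gset_infP (S : set (Gset I)) G :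
  (forall x, (G : set W1) x <-> forall H, S H -> (H : set W1) x) ->
  infimums S G.
Proof.
move=> GP; split=> [H SH|H HS]; apply/Gset_leP => x.
- by move=> /GP; apply.
- by move=> Hx; apply/GP => K SK; exact: (Gset_leP _ _ (HS K SK)).
Qed.

Lemma Gset_complete : complete_lattice (Gset I).
Proof.
move=> S; split.
(* The polar of a union is the intersection of the polars, so this is the closure of the union of
   [S]. *)
- exists (Glpolar (fun y => forall G, S G -> rpolar I G y)); split.
  + by move=> G SG; apply/Gset_leP => x Gx y yS; exact: (yS G SG).
  + move=> H HS; apply/Gset_leP => x xS; apply/Gset_polarP => y Hy.
    by apply: xS => G SG z Gz; apply: Hy; exact: (Gset_leP _ _ (HS G SG)).
(* The intersection of [S], presented as the polar of a union of polars so that stability comes for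
   free. *)
- exists (Glpolar (fun y => exists2 G, S G & rpolar I G y)).
  apply: Gset_infP => x; split=> [xS G SG|xS y [G SG]].
  + by apply/Gset_polarP => y Gy; apply: xS; exists G.
  + by move: y; apply/Gset_polarP; exact: xS.
Qed.

End GaloisStable.

Section Representation.
Context (d : Order.disp_t) (P : porderType d).
Implicit Types (a b : P) (x z : Filt P) (y : Idl P) (S : set P).
Implicit Types G : Gset (@disj d P).

Lemma principal_filterP a : is_filter [set b | a <= b].
Proof.
split; first by exists a => /=.
- by move=> b c /= bc ab; exact: le_trans bc.
- by move=> b c /= ab ac; exists a; split=> /=.
Qed.

Definition principal_filter a : Filt P := MkFilt (principal_filterP a).

Lemma filter_up x a b : a <= b -> (x : set P) a -> (x : set P) b.
Proof. by case: (filtP x) => _ up _; exact: up. Qed.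

Lemma ideal_down y a b : a <= b -> (y : set P) b -> (y : set P) a.
Proof. by case: (idlP y) => _ dn _; exact: dn. Qed.

Lemma perp_disjP x y :
  perp (@disj d P) x y <-> exists2 a, (x : set P) a & (y : set P) a.
Proof.
rewrite /perp /disj; split=> [/eqP/set0P[a [xa ya]]|[a xa ya] xy0].
  by exists a.
by have : ((x : set P) `&` (y : set P)) a by []; rewrite xy0.
Qed.

Lemma perp_principal_filter a y :
  perp (@disj d P) (principal_filter a) y <-> (y : set P) a.
Proof.
split=> [/perp_disjP[b /= ab]|ya]; first exact: ideal_down.
by apply/perp_disjP; exists a => /=.
Qed.

(** Induction along an enumeration of [S]: nonemptiness of [x] settles the empty set, and
    directedness absorbs one more element. *)
Lemma filter_finite_lbound x S :
  finite_set S -> S `<=` x -> exists2 c, (x : set P) c & lbound S c.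
Proof.
case: (filtP x) => [[e xe] _ dir] /finite_seqP[s ->].
elim: s => [|a s IH] sx; first by exists e.
have [b bs|c xc cs] := IH; first by apply: sx; rewrite /= inE bs orbT.
have [|e' [xe' e'a e'c]] := dir a c _ xc; first by apply: sx; rewrite /= mem_head.
exists e' => // b /=; rewrite inE => /predU1P[->//|bs].
exact/(le_trans e'c)/cs.
Qed.

Lemma ideal_finite_ubound y S :
  finite_set S -> S `<=` y -> exists2 c, (y : set P) c & ubound S c.
Proof.
case: (idlP y) => [[e ye] _ dir] /finite_seqP[s ->].
elim: s => [|a s IH] sy; first by exists e.
have [b bs|c yc cs] := IH; first by apply: sy; rewrite /= inE bs orbT.
have [|e' [ye' ae' ce']] := dir a c _ yc; first by apply: sy; rewrite /= mem_head.
exists e' => // b /=; rewrite inE => /predU1P[->//|bs].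
exact/(le_trans _ ce')/cs.
Qed.

Lemma alpha_mono : {mono @alpha d P : a b / a <= b}.
Proof.
move=> a b; apply/Gset_leP/idP => [ab|ab x]; last exact: filter_up.
(* The principal filter of [a] is a point of [alpha a]; its membership in [alpha b] is exactly
   [a <= b]. *)
exact: (ab (principal_filter a) (lexx a)).
Qed.

Lemma alpha_finite_joins : preserves_finite_joins (@alpha d P).
Proof.
move=> S s finS [ubs lubs]; split=> [_ [a Sa <-]|G Gub].
  by rewrite alpha_mono; exact: ubs.
apply/Gset_leP => x xs; apply/Gset_polarP => y Gy.
have [|c yc Sc] := @ideal_finite_ubound y S finS.
  move=> a Sa; apply/perp_principal_filter/Gy.
  apply: (Gset_leP _ _ (Gub (alpha a) _)); first by exists a.
  exact: (lexx a).
(* The least upper bound [s] lies below [c], hence in the ideal [y]; it is the common element of [x]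
   and [y]. *)
apply/perp_disjP; exists s => //; apply: ideal_down yc; exact: lubs.
Qed.

(** A filter containing [S] contains a lower bound of [S], which lies below the meet [s], hence it
    contains [s]. *)
Lemma alpha_finite_meets : preserves_finite_meets (@alpha d P).
Proof.
move=> S s finS [lbs glbs]; apply: Gset_infP => x; split=> [xs _ [a Sa <-]|xS].
  by apply: filter_up xs; exact: lbs.
have [|c xc cS] := @filter_finite_lbound x S finS.
  by move=> a Sa; apply: (xS (alpha a)); exists a.
by apply: filter_up xc; exact: glbs.
Qed.

(** The closure of the singleton of [x]: the inner set is the polar of that singleton. *)
Definition filter_meet x := Glpolar (@disj d P) [set y | perp (@disj d P) x y].

Definition ideal_join y := Glpolar (@disj d P) [set y].

Lemma filter_meetP x z : (filter_meet x : set _) z <-> (x : set P) `<=` z.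
Proof.
split=> [zx a xa|xz y /perp_disjP[a xa ya]]; last first.
  by apply/perp_disjP; exists a => //; exact: xz.
(* Testing [z] against the principal ideal of [a], which [x] meets in [a], yields an element of [z]
   below [a]. *)
have [|b zb /= ba] := (perp_disjP _ _).1 (zx (MkIdl (principal_idealP a)) _).
  by apply/perp_disjP; exists a => /=.
exact: filter_up zb.
Qed.

Lemma ideal_joinP y z :
  (ideal_join y : set _) z <-> exists2 a, (z : set P) a & (y : set P) a.
Proof.
rewrite -perp_disjP; split=> [|zy _ ->//].
exact.
Qed.

Lemma filter_meet_inf x : infimums (@alpha d P @` x) (filter_meet x).
Proof.
apply: Gset_infP => z; rewrite filter_meetP.
split=> [xz _ [a xa <-]|zx a xa]; first exact: xz.
by apply: (zx (alpha a)); exists a.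
Qed.

Lemma ideal_join_sup y : supremums (@alpha d P @` y) (ideal_join y).
Proof.
split=> [_ [a ya <-]|G Gub]; apply/Gset_leP => z.
  by move=> za; apply/ideal_joinP; exists a.
move=> /ideal_joinP[a za ya].
by apply: (Gset_leP _ _ (Gub (alpha a) _)) za; exists a.
Qed.

(** Every [y] in the polar of [G] meets each [x] in [G], so [filter_meet x] stays inside [G];
    conversely each [z] belongs to [filter_meet z]. *)
Lemma filter_meet_dense G :
  supremums (filter_meet @` (G : set (Filt P))) G.
Proof.
split=> [_ [x Gx <-]|H Hub]; apply/Gset_leP => z.
  move=> zx; apply/Gset_polarP => y Gy; apply: zx.
  exact: Gy.
move=> Gz; apply: (Gset_leP _ _ (Hub (filter_meet z) _)); first by exists z.
exact/filter_meetP.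
Qed.

(** This is stability itself: the double polar of [G] is the intersection of the polars of single
    ideals. *)
Lemma ideal_join_dense G :
  infimums (ideal_join @` rpolar (@disj d P) G) G.
Proof.
apply: Gset_infP => x; split=> [Gx _ [y Gy <-] _ ->|xG]; first exact: Gy.
by apply/Gset_polarP => y Gy; apply: (xG (ideal_join y)) => //; exists y.
Qed.

End Representation.

Theorem proposition1 (d : Order.disp_t) (P : porderType d) :
  is_Delta1_completion (@alpha d P).
Proof.
split.
- split; [exact: Gset_complete|exact: alpha_mono|..].
  + exact: alpha_finite_joins.
  + exact: alpha_finite_meets.
- move=> G; exists (@filter_meet d P @` G); last exact: filter_meet_dense.
  by move=> _ [x _ <-]; exists x; exact: filter_meet_inf.
- move=> G; exists (@ideal_join d P @` rpolar (@disj d P) G).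
  + by move=> _ [y _ <-]; exists y; exact: ideal_join_sup.
  + exact: ideal_join_dense.
Qed.
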